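(* Let $\mathbf{x}\in\mathbf{X}$ be the generalized cycle of $\operatorname{cl}(\mathbf{f}\Box\iota_\Delta)$, i.e., $$0\in\partial[\operatorname{cl}(\mathbf{f}\Box\iota_{\Delta})](\mathbf{x})+(\operatorname{Id}-\mathbf{R})\mathbf{x}\quad\text{and}\quad\mathbf{x}\in\Delta^\perp.$$ If $[\operatorname{cl}(\mathbf{f}\Box\iota_\Delta)](\mathbf{x})=(\mathbf{f}\Box\iota_\Delta)(\mathbf{x})$ and $\mathbf{f}\Box\iota_\Delta$ is exact at $\mathbf{x}$, then there exists $\mathbf{u}\in\mathbf{X}$ such that $\mathbf{x}=\mathbf{u}+\mathbf{v}$ with $\mathbf{v}=-P_\Delta(\mathbf{u})\in\Delta$, and $$0\in\partial\mathbf{f}(\mathbf{u})+(\operatorname{Id}-\mathbf{R})\mathbf{u}.$$ Consequently, $\mathbf{u}$ is a classical cycle for $\mathbf{f}$.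
   Context: $X$ is a real Hilbert space, $m\in\{1,2,\dots\}$, $\mathbf{X}=X^m$ is the product Hilbert space. $\Delta=\{(x,\dots,x): x\in X\}\subseteq\mathbf{X}$, $\Delta^\perp$ is its orthogonal complement, $P_\Delta$ the orthogonal projection onto $\Delta$, and $\mathbf{R}(x_1,\dots,x_m)=(x_m,x_1,\dots,x_{m-1})$. $f_1,\dots,f_m$ are proper lower semicontinuous convex functions $X\to\,]-\infty,+\infty]$, and $\mathbf{f}(x_1,\dots,x_m)=\sum_{i=1}^m f_i(x_i)$. $\iota_\Delta$ is the indicator function of $\Delta$; $(\mathbf{f}\Box\iota_\Delta)(\mathbf{x})=\inf_{\mathbf{u}\in\mathbf{X}}(\mathbf{f}(\mathbf{u})+\iota_\Delta(\mathbf{x}-\mathbf{u}))$ is the infimal convolution, which is exact at $\mathbf{x}$ if there is $\mathbf{u}\in\mathbf{X}$ with $(\mathbf{f}\Box\iota_\Delta)(\mathbf{x})=\mathbf{f}(\mathbf{u})+\iota_\Delta(\mathbf{x}-\mathbf{u})$; $\operatorname{cl}$ denotes the lower semicontinuous hull and $\partial$ the convex subdifferential. Standing assumption: $\operatorname{dom}\mathbf{f}^*\cap\Delta^\perp\neq\varnothing$ ($\mathbf{f}^*$ the Fenchel conjugate). A classical cycle of $\mathbf{f}$ is $\mathbf{z}=(z_1,\dots,z_m)\in\mathbf{X}$ with $z_1=\operatorname{Prox}_{f_1}z_m$ and $z_i=\operatorname{Prox}_{f_i}z_{i-1}$ for $2\le i\le m$, where $\operatorname{Prox}_{f_i}=(\operatorname{Id}+\partial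 f_i)^{-1}$; equivalently, $0\in\partial\mathbf{f}(\mathbf{z})+\mathbf{z}-\mathbf{R}\mathbf{z}$. *)

(* Defs.v *)
From HB Require Import structures.
From mathcomp Require Import all_boot all_order all_algebra.
From mathcomp Require Import all_classical all_reals all_analysis.
From mathcomp Require Import sesquilinear.

Set Implicit Arguments.
Unset Strict Implicit.
Unset Printing Implicit Defensive.

Import Order.TTheory GRing.Theory Num.Theory.
Import numFieldNormedType.Exports.

Local Open Scope classical_set_scope.
Local Open Scope ring_scope.

(* A real Hilbert space is a completeNormedModType X over a realType R with an
   inner product dot : {dot X for idfun} such that `|a| ^+ 2 = dot a a.
   The product space X^m is the function space 'I_m -> X, with the pointwise
   lmodType structure, the inner product prod_dot, and the topology of
   {ptws 'I_m -> X}, which nbhs_prod_dot shows to be the norm topology. *)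

Section ConvexAnalysis.
Context {R : realType} {V : lmodType R}.
Implicit Types (dot : {dot V for idfun}) (f g : V -> \bar R) (C : set V).

Definition dom f : set V := [set x | (f x < +oo)%E].

Definition proper_fun f := (forall x, (-oo < f x)%E) /\ dom f !=set0.

(* Meaningful for functions that do not take the value -oo. *)
Definition convex_ereal f := forall (x y : V) (t : R), 0 < t < 1 ->
  (f (t *: x + (1 - t) *: y)%R <= t%:E * f x + (1 - t)%:E * f y)%E.

Definition indicator C (x : V) : \bar R := if x \in C then 0%E else +oo%E.

Definition inf_conv f g (x : V) : \bar R :=
  ereal_inf [set (f u + g (x - u)%R)%E | u in [set: V]].

Definition inf_conv_exact f g (x : V) :=
  exists u, inf_conv f g x = (f u + g (x - u)%R)%E.

Definition fenchel dot f (u : V) : \bar R :=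
  ereal_sup [set ((dot x u)%:E - f x)%E | x in [set: V]].

Definition subdiff dot f (x : V) : set V :=
  [set s | forall y, ((dot (y - x) s)%:E + f x <= f y)%E].

(* Prox_f = (Id + \partial f)^-1 as a set-valued operator. *)
Definition prox dot f (y : V) : set V :=
  [set p | exists2 s, subdiff dot f p s & y = p + s].

Definition orthc dot C : set V := [set u | forall c, C c -> dot c u = 0].

(* The orthogonal projection onto a linear subspace C; it is unique where it
   exists, and 0 is a default value where it does not. *)
Definition orth_proj dot C (x : V) : V :=
  xget 0 [set p | C p /\ orthc dot C (x - p)].

End ConvexAnalysis.

(* The largest lower semicontinuous minorant. *)
Definition lsc_hull {R : realType} {T : topologicalType} (g : T -> \bar R)
    (x : T) : \bar R :=
  ereal_sup [set h x | h in [set h : T -> \bar R |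
    lower_semicontinuous h /\ forall y, (h y <= g y)%E]].

Section ProductSpace.
Context {R : realType} {X : completeNormedModType R} {m : nat}.
Implicit Types (dot : {dot X for idfun}) (x y : 'I_m -> X).

Definition prod_dot dot x y : R := \sum_(i < m) dot (x i) (y i).

Section Instance.
Variable dot : {dot X for idfun}.

Let prod_dotDl y : zmod_morphism ((prod_dot dot) ^~ y).
Proof.
move=> a b; rewrite /prod_dot -sumrB; apply: eq_bigr => i _.
exact: (@zmod_morphisml_subproof _ _ _ _ _ _ dot).
Qed.

Let prod_dotDr x : zmod_morphism (prod_dot dot x).
Proof.
move=> a b; rewrite /prod_dot -sumrB; apply: eq_bigr => i _.
exact: (@zmod_morphismr_subproof _ _ _ _ _ _ dot).
Qed.

Let prod_dotZl y : scalable_for *%R ((prod_dot dot) ^~ y).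
Proof.
move=> k a; rewrite /prod_dot mulr_sumr; apply: eq_bigr => i _.
exact: (@linearl_subproof _ _ _ _ _ _ dot).
Qed.

Let prod_dotZr x : scalable_for (idfun \; *%R) (prod_dot dot x).
Proof.
move=> k a; rewrite /prod_dot /= mulr_sumr; apply: eq_bigr => i _.
exact: (@linearr_subproof _ _ _ _ _ _ dot).
Qed.

HB.instance Definition _ := @isBilinear.Build R ('I_m -> X) ('I_m -> X) R
  *%R (idfun \; *%R) (prod_dot dot)
  prod_dotDl prod_dotDr prod_dotZl prod_dotZr.

Let prod_dot_sym x y :
  prod_dot dot x y = (-1) ^+ false * idfun (prod_dot dot y x).
Proof.
rewrite expr0 mul1r /prod_dot; apply: eq_bigr => i _.
by rewrite (@hermitian_subproof _ _ _ _ dot) expr0 mul1r.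
Qed.

HB.instance Definition _ := @isHermitianSesquilinear.Build R ('I_m -> X)
  false idfun (prod_dot dot) prod_dot_sym.

Let dot_ge0 a : 0 <= dot a a.
Proof.
have [->|a0] := eqVneq a 0; last exact/ltW/neq0_dnorm_gt0.
by rewrite linear0l.
Qed.

Let prod_dot_gt0 x : x != 0 -> 0 < prod_dot dot x x.
Proof.
move=> x0; rewrite lt_neqAle sumr_ge0 ?andbT//; apply: contra_neqN x0.
rewrite eq_sym psumr_eq0// => /allP x0; apply/funext => i; apply/eqP.
by apply: contraLR (x0 i (mem_index_enum _)) => /neq0_dnorm_gt0 /gt_eqF ->.
Qed.

HB.instance Definition _ := @isDotProduct.Build R ('I_m -> X)
  (prod_dot dot) prod_dot_gt0.

End Instance.

Lemma nbhs_prod_dot dot (norm_dot : forall a : X, `|a| ^+ 2 = dot a a)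
    (x : {ptws 'I_m -> X}) (A : set {ptws 'I_m -> X}) :
  nbhs x A <-> exists2 e : R, 0 < e &
    forall y : 'I_m -> X, prod_dot dot (y - x) (y - x) < e ^+ 2 -> A y.
Proof.
have coordE (y : 'I_m -> X) i :
    `|y i - x i| ^+ 2 <= prod_dot dot (y - x) (y - x).
  rewrite norm_dot /prod_dot (bigD1 i)//= lerDl sumr_ge0// => j _.
  by rewrite -norm_dot exprn_ge0.
pose F : set_system {ptws 'I_m -> X} := filter_from [set e : R | 0 < e]
  (fun e => [set y | prod_dot dot (y - x) (y - x) < e ^+ 2]).
have FF : Filter F.
  apply: filter_from_filter; first by exists 1 => /=.
  move=> d e /= d0 e0; exists (Num.min d e); first by rewrite /= lt_min d0.
  move=> y /= yde; have mde : 0 <= Num.min d e by rewrite le_min !ltW.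
  split; apply: (lt_le_trans yde); rewrite lerXn2r ?nnegrE ?(ltW d0) ?(ltW e0)//;
    by rewrite ge_min lexx ?orbT.
have Fx : F --> x.
  apply/cvg_sup => i; apply/cvg_image.
    rewrite eqEsubset; split => // a _; exists (fun=> a) => //.
  move=> B /nbhs_ballP[e /= e0 eB].
  exists ((fun y : {ptws 'I_m -> X} => y i) @^-1` B).
    exists e => //= y ye; apply: eB; rewrite -ball_normE /= distrC.
    have := le_lt_trans (coordE y i) ye.
    by rewrite ltr_pXn2r ?nnegrE ?(ltW e0).
  rewrite eqEsubset; split => [a [y By <-]//|a Ba]; by exists (fun=> a).
split=> [/Fx [e /= e0 eA]|[e e0 eA]]; first by exists e.
have m1 : 0 < m.+1%:R :> R by rewrite ltr0n.
pose d : R := e / m.+1%:R; have d0 : 0 < d by rewrite divr_gt0.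
have small (y : 'I_m -> X) :
    (forall i, ball (x i) d (y i)) -> prod_dot dot (y - x) (y - x) < e ^+ 2.
  move=> xy; rewrite /prod_dot.
  have -> : e ^+ 2 = e ^+ 2 / m.+1%:R + \sum_(i < m) e ^+ 2 / m.+1%:R.
    rewrite sumr_const card_ord -[_ *+ m]mulr_natr -[X in X + _]mulr1 -mulrDr.
    by rewrite -[1 + _](natrD _ 1 m) divfK// gt_eqF.
  have e2 : 0 < e ^+ 2 / m.+1%:R by rewrite divr_gt0// exprn_gt0.
  apply: ltr_pwDl => //; apply: ler_sum => i _; rewrite -norm_dot.
  have : `|y i - x i| < d by have := xy i; rewrite -ball_normE /= distrC.
  move=> xyd; have d2 : d ^+ 2 <= e ^+ 2 / m.+1%:R.
    rewrite /d expr_div_n ler_pM2l ?exprn_gt0// lef_pV2 ?posrE ?exprn_gt0//.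
    by rewrite expr2 ler_peMr ?ler1n ?(ltW m1).
  apply: le_trans d2; change (`|y i - x i| ^+ 2 <= d ^+ 2).
  by rewrite lerXn2r ?nnegrE ?(ltW xyd) ?(ltW d0).
have near_x : nbhs x [set y | forall i, ball (x i) d (y i)].
  apply: (@filter_forall {ptws 'I_m -> X} 'I_m
    (fun i => [set y | ball (x i) d (y i)]) (nbhs x) (nbhs_filter x)) => i.
  have := @proj_continuous 'I_m (fun=> X : topologicalType) i x.
  by move=> /(_ _ (nbhsx_ballx (x i) d d0)).
have sub : [set y | forall i, ball (x i) d (y i)] `<=` A.
  by move=> y /small; exact: eA.
exact: (@filterS _ _ (nbhs_filter x) _ _ sub near_x).
Qed.

Definition diag : set ('I_m -> X) := [set x | exists a : X, x = fun=> a].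

Lemma orth_proj_diag dot x : (0 < m)%N ->
  orth_proj (prod_dot dot) diag x = fun=> m%:R^-1 *: \sum_(i < m) x i.
Proof.
move=> m0; set a := m%:R^-1 *: _; have mN0 : m%:R != 0 :> R by rewrite pnatr_eq0 -lt0n.
have dB b : zmod_morphism (dot b).
  exact: (@zmod_morphismr_subproof _ _ _ _ _ _ dot).
have d0 b : dot b 0 = 0 by rewrite -(subrr 0) dB subrr.
have dD b u v : dot b (u + v) = dot b u + dot b v.
  by rewrite -[v in LHS]opprK -[- v]sub0r !dB d0 sub0r opprK.
have aorth : orthc (prod_dot dot) diag (x - fun=> a).
  move=> _ [b ->]; rewrite /prod_dot.
  transitivity (\sum_(i < m) dot b (x i - a)) => //; rewrite -(big_morph _ (dD b) (d0 b)) sumrB.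
  rewrite sumr_const card_ord /a -[X in _ - X]scaler_nat scalerA divff// scale1r.
  by rewrite subrr d0.
apply: xget_unique => [|p [[b ->] borth]]; first by split => //; exists a.
set w : 'I_m -> X := fun=> b - a.
suff /eqP : prod_dot dot w w = 0.
  apply: contraTeq => ab; rewrite gt_eqF//; apply: neq0_dnorm_gt0.
  by rewrite -subr_eq0 in ab.
have wE : w = (x - fun=> a) - (x - fun=> b).
  by apply/funext => i; rewrite /w !fctE opprB [RHS]addrC subrKA.
have wdiag : diag w by exists (b - a).
have Ea : prod_dot dot w (x - fun=> a) = 0 := aorth _ wdiag.
have Eb : prod_dot dot w (x - fun=> b) = 0 := borth _ wdiag.
rewrite {2}wE; have -> : prod_dot dot w ((x - fun=> a) - (x - fun=> b)) =
    prod_dot dot w (x - fun=> a) - prod_dot dot w (x - fun=> b).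
  exact: (@zmod_morphismr_subproof _ _ _ _ _ _ (prod_dot dot)).
by rewrite Ea Eb subrr.
Qed.

(* R(x_1, ..., x_m) = (x_m, x_1, ..., x_(m-1)): ord_pred is the cyclic
   predecessor on 'I_m. *)
Definition cshift x : 'I_m -> X := fun i => x (ord_pred i).

Definition sep_sum (f : 'I_m -> X -> \bar R) x : \bar R :=
  (\sum_(i < m) f i (x i))%E.

(* 0 \in \partial g(x) + (Id - R) x *)
Definition cycle_inclusion dot (g : ('I_m -> X) -> \bar R) x :=
  [set s + (x - cshift x) | s in subdiff (prod_dot dot) g x] 0.

(* z_1 = Prox_{f_1} z_m and z_i = Prox_{f_i} z_(i-1) for 2 <= i <= m, as
   Prox_{f_i} is single-valued. *)
Definition classical_cycle dot (f : 'I_m -> X -> \bar R) (z : 'I_m -> X) :=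
  forall i, prox dot (f i) (z (ord_pred i)) = [set z i].

End ProductSpace.

Arguments diag {R} X m.

(* Main.v *)
Require Import Defs.
From mathcomp Require Import all_boot all_order all_algebra.
From mathcomp Require Import all_classical all_reals all_analysis.
From mathcomp Require Import sesquilinear lra.

Import Order.TTheory GRing.Theory Num.Theory.
Import numFieldNormedType.Exports.

Local Open Scope classical_set_scope.
Local Open Scope ring_scope.

(** The proof transports one subgradient.  Write F for [sep_sum f] and G for
    the infimal convolution of F with the indicator of the diagonal.  The
    inclusion satisfied by x says that s = R x - x is a subgradient at x of the
    lower semicontinuous hull of G.  The hull is a minorant of G that agrees
    with G at x, so s is also a subgradient of G at x ([subdiff_minorant]).

    Let G x = F u + i(x - u) be an exact decomposition, where i is the
    indicator.  Subgradients of an infimal convolution pass to its exact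
    summands ([subdiff_inf_conv]): perturbing u to w and x to w + (x - u) costs
    at most F w - F u.  Hence s is a subgradient of F at u, and v = x - u lies
    in the diagonal, since only there the indicator is finite.  The shift fixes
    the diagonal pointwise, so s = R x - x = R u - u, which is the inclusion
    for u.  As u - (- v) = x is orthogonal to the diagonal, - v is the
    projection of u.

    Finally, the i-th component R u i - u i of this subgradient is a
    subgradient of [f i] at [u i], because F is separable
    ([subdiff_sep_sum]).  So [u i] is a proximal point of [u (ord_pred i)],
    and the only one because subdifferentials are monotone ([prox_subdiff]). *)

Section Subdifferential.
Context {R : realType} {V : lmodType R}.
Implicit Types (dot : {dot V for idfun}) (f g : V -> \bar R) (C : set V).

Lemma dot_le0_eq0 dot x : dot x x <= 0 -> x = 0.
Proof.
by apply: contraPeq => x0; apply/negP; rewrite -ltNge neq0_dnorm_gt0.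
Qed.

(** A subgradient at a point where f is +oo would force f to be +oo
    everywhere. *)
Lemma subdiff_fin_num dot f x s : proper_fun f -> subdiff dot f x s ->
  f x \is a fin_num.
Proof.
move=> [fNy [a fa]] /(_ a) fs.
rewrite fin_real // fNy ltey /=; apply/eqP => fxy.
by move: fs; rewrite fxy addey // leye_eq => /eqP fay; move: fa; rewrite /dom /= fay.
Qed.

Lemma subdiff_minorant dot f g x : (forall y, f y <= g y)%E -> f x = g x ->
  subdiff dot f x `<=` subdiff dot g x.
Proof. by move=> fg fgx s fs y; rewrite -fgx (le_trans (fs y)). Qed.

(** Adding the subgradient inequalities for two proximal points p and q of the
    same point gives |q - p|^2 <= 0: this is the monotonicity of the
    subdifferential. The finiteness of [f p] and [f q] lets them cancel. *)
Lemma prox_subdiff dot f p s : proper_fun f -> subdiff dot f p s ->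
  prox dot f (p + s) = [set p].
Proof.
move=> fP fs; apply/seteqP; split => [q [t ft pq]|_ ->]; last by exists s.
have fp := subdiff_fin_num _ _ _ _ fP fs.
have fq := subdiff_fin_num _ _ _ _ fP ft.
move: (fs q) (ft p); rewrite -(fineK fp) -(fineK fq) -!EFinD !lee_fin => h1 h2.
have ts : s - t = q - p.
  by apply/eqP; rewrite subr_eq addrAC -pq [p + s]addrC addrK.
have : dot (q - p) (q - p) <= 0.
  rewrite -{2}ts linearBr /=; rewrite -(opprB q p) linearNl /= in h2.
  lra.
by move=> /dot_le0_eq0 /eqP; rewrite subr_eq0 => /eqP.
Qed.

Lemma inf_conv_le f g a b : (inf_conv f g (a + b)%R <= f a + g b)%E.
Proof. by apply: ereal_inf_lbound; exists a => //; rewrite [a + b]addrC addrK. Qed.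

(** The bound [inf_conv f g (w + (x - u)) <= f w + g (x - u)] turns the
    subgradient inequality at x into the one at u, after cancelling
    [g (x - u)]. The cancellation requires this value to be finite, which
    holds because [inf_conv f g] is below +oo somewhere, hence at x too. *)
Lemma subdiff_inf_conv dot f g x u s : proper_fun f -> proper_fun g ->
  inf_conv f g x = (f u + g (x - u)%R)%E ->
  subdiff dot (inf_conv f g) x s -> subdiff dot f u s /\ dom g (x - u).
Proof.
move=> [fNy [a fa]] [gNy [b gb]] xE xs.
have : (f u + g (x - u)%R < +oo)%E.
  rewrite ltey -xE; apply/eqP => xy.
  have := le_lt_trans (le_trans (xs (a + b)) (inf_conv_le f g a b))
    (lte_add_pinfty fa gb).
  by rewrite xy addey.
have [gxu|gxu] := eqVneq (g (x - u)) +oo%E.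
  by rewrite gxu addey // gt_eqF.
move=> _; split; last by rewrite /dom /= ltey.
have gfin : g (x - u) \is a fin_num by rewrite fin_real // gNy ltey.
move=> w; rewrite -(leeD2rE _ _ gfin) -addeA -xE.
have := le_trans (xs (w + (x - u))) (inf_conv_le f g w (x - u)).
by rewrite addrCA addrAC subrr add0r.
Qed.

Lemma proper_indicator C : C !=set0 -> proper_fun (indicator C).
Proof.
move=> [a Ca]; split => [x|]; first by rewrite /indicator; case: ifP.
by exists a; rewrite /dom /= /indicator mem_set.
Qed.

Lemma dom_indicator C : dom (indicator C) `<=` C.
Proof. by move=> x; rewrite /dom /= /indicator; case: ifPn => [/set_mem|]. Qed.

(** Two candidates differ by a vector of C that is orthogonal to itself. *)
Lemma orth_proj_unique dot C x p : (forall a b, C a -> C b -> C (a - b)) ->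
  C p -> orthc dot C (x - p) -> orth_proj dot C x = p.
Proof.
move=> CB Cp pO; apply: xget_unique => // q [Cq qO].
have Cqp : C (q - p) := CB _ _ Cq Cp.
apply/eqP; rewrite -subr_eq0; apply/eqP; apply: (dot_le0_eq0 dot).
have {2}-> : q - p = (x - p) - (x - q) by rewrite opprB [RHS]addrC subrKA.
by rewrite linearBr /= pO // qO // subrr.
Qed.

End Subdifferential.

Lemma lsc_hull_le {R : realType} {T : topologicalType} (g : T -> \bar R) x :
  (lsc_hull g x <= g x)%E.
Proof. by apply: ge_ereal_sup => _ [h [_ hg] <-]. Qed.

Section Product.
Context {R : realType} {X : completeNormedModType R} {m : nat}.
Implicit Types (dot : {dot X for idfun}) (f : 'I_m -> X -> \bar R).

Lemma proper_sep_sum f : (forall i, proper_fun (f i)) -> proper_fun (sep_sum f).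
Proof.
move=> fP; split => [x|].
  rewrite /sep_sum; elim/big_ind : _ => [|a b|i _]; first exact: ltNyr.
    by rewrite !ltNye adde_eq_ninfty negb_or => -> ->.
  exact: (fP i).1.
have /choice[a fa] : forall i, exists a, dom (f i) a by move=> i; exact: (fP i).2.
by exists a; apply: lte_sum_pinfty => i _; exact: fa.
Qed.

(** Test the subgradient inequality on the points that differ from u in the
    i-th coordinate only; the other summands are finite and cancel. *)
Lemma subdiff_sep_sum dot f u s i : (forall i, proper_fun (f i)) ->
  subdiff (prod_dot dot) (sep_sum f) u s -> subdiff dot (f i) (u i) (s i).
Proof.
move=> fP us a.
have ufin : sep_sum f u \is a fin_num.
  exact: subdiff_fin_num (proper_sep_sum _ fP) us.
pose w : 'I_m -> X := fun j => if j == i then a else u j.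
have wi : w i = a by rewrite /w eqxx.
have wj j : j != i -> w j = u j by rewrite /w => /negPf ->.
have dotE : prod_dot dot (w - u) s = dot (a - u i) (s i).
  rewrite /prod_dot (bigD1 i) //= big1 => [|j /wj jE].
    by rewrite addr0 !fctE wi.
  by rewrite !fctE jE subrr linear0l.
have : ((prod_dot dot (w - u) s)%:E + sep_sum f u <= sep_sum f w)%E := us w.
have sumD1 z :
    sep_sum f z = (f i (z i) + \sum_(j < m | j != i) f j (z j))%E.
  by rewrite /sep_sum (bigD1 i).
rewrite dotE !sumD1 wi.
rewrite [X in (_ <= _ + X)%E](eq_bigr (fun j => f j (u j))) => [|j /wj -> //].
have rfin : (\sum_(j < m | j != i) f j (u j))%E \is a fin_num.
  apply/sum_fin_numP => j _ _.
  by move/sum_fin_numP : ufin; apply => //; rewrite mem_index_enum.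
by rewrite addeA leeD2rE.
Qed.

Lemma diagB (a b : 'I_m -> X) : diag X m a -> diag X m b -> diag X m (a - b).
Proof. by move=> [p ->] [q ->]; exists (p - q). Qed.

Lemma diag_sub_cshift (v w : 'I_m -> X) : diag X m v ->
  (w + v) - cshift (w + v) = w - cshift w.
Proof. by move=> [a ->]; apply/funext => i; rewrite /cshift !fctE opprD addrACA subrr addr0. Qed.

End Product.

Theorem theorem4p3 (R : realType) (X : completeNormedModType R)
    (dot : {dot X for idfun}) (norm_dot : forall a : X, `|a| ^+ 2 = dot a a)
    (m : nat) (m_gt0 : (0 < m)%N) (f : 'I_m -> X -> \bar R)
    (f_proper : forall i, proper_fun (f i))
    (f_lsc : forall i, lower_semicontinuous (f i))
    (f_convex : forall i, convex_ereal (f i))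
    (dom_fenchel :
      dom (fenchel (prod_dot dot) (sep_sum f))
        `&` orthc (prod_dot dot) (diag X m) !=set0)
    (x : 'I_m -> X)
    (x_cycle : cycle_inclusion dot
      (@lsc_hull R {ptws 'I_m -> X}
        (inf_conv (sep_sum f) (indicator (diag X m)))) x)
    (x_orth : orthc (prod_dot dot) (diag X m) x)
    (x_closed :
      @lsc_hull R {ptws 'I_m -> X}
        (inf_conv (sep_sum f) (indicator (diag X m))) x
      = inf_conv (sep_sum f) (indicator (diag X m)) x)
    (x_exact : inf_conv_exact (sep_sum f) (indicator (diag X m)) x) :
  exists u v : 'I_m -> X,
    [/\ x = u + v, v = - orth_proj (prod_dot dot) (diag X m) u,
        diag X m v, cycle_inclusion dot (sep_sum f) u &
        classical_cycle dot f u].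
Proof.
have FP := proper_sep_sum f f_proper.
have iP : proper_fun (indicator (diag X m)).
  by apply: proper_indicator; exists (fun=> 0); exists 0.
case: x_exact => u uE; case: x_cycle => s s_hull s0.
set G := inf_conv _ _ in uE s_hull x_closed.
have s_conv : subdiff (prod_dot dot) G x s.
  apply: subdiff_minorant x_closed _ s_hull => y.
  exact: (@lsc_hull_le R {ptws 'I_m -> X}).
have [us /dom_indicator vD] := subdiff_inf_conv _ _ _ _ _ _ FP iP uE s_conv.
have xuv : x = u + (x - u) by rewrite addrC subrK.
have u0 : s + (u - cshift u) = 0.
  by rewrite -(diag_sub_cshift (x - u) u vD) -xuv.
have sE i : u (ord_pred i) = u i + s i.
  move/(congr1 (fun h => h i)) : u0; rewrite !fctE /cshift => /eqP.
  by rewrite addrA subr_eq0 addrC => /eqP.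
exists u, (x - u); split => //.
- have NvD : diag X m (- (x - u)).
    by rewrite -sub0r; apply: diagB => //; exists 0.
  rewrite (orth_proj_unique (prod_dot dot) _ u _ diagB NvD) ?opprK //.
  by rewrite -xuv.
- by exists s.
- by move=> i; rewrite sE; apply: prox_subdiff => //; exact: subdiff_sep_sum.
Qed.
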